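(* Let $\Delta=\delta_1\delta_2\ldots \in \{0,1\}^{\mathbb N}$ and $\Theta=\vartheta_1\vartheta_2\ldots \in \{E,R\}^{\mathbb N}$, and let $\mathbf u(\Delta,\Theta)$ be the binary generalized pseudostandard word with directive bi-sequence $(\Delta,\Theta)$. Then $\mathbf u(\Delta,\Theta)$ is periodic if and only if $$(\exists a \in \{0,1\})(\exists \vartheta \in \{E,R\})(\exists n_0 \in \mathbb N)(\forall n>n_0,\ n \in \mathbb N)\ (\delta_{n+1}=a \Leftrightarrow \vartheta_n =\vartheta).$$
   Context: An involutory antimorphism on $\mathcal A^*$ is a map $\vartheta:\mathcal A^*\to\mathcal A^*$ with $\vartheta(vw)=\vartheta(w)\vartheta(v)$ for all $v,w$ and $\vartheta^2=\mathrm{id}$; it is determined by its values on letters. Over $\mathcal A=\{0,1\}$ there are exactly two: the reversal $R$ ($R(0)=0$, $R(1)=1$) and the exchange antimorphism $E$ ($E(0)=1$, $E(1)=0$). A finite word $w$ is a $\vartheta$-palindrome if $w=\vartheta(w)$. The $\vartheta$-palindromic closure $w^{\vartheta}$ of a finite word $w$ is the shortest $\vartheta$-palindrome having $w$ as a prefix. Given $\Delta=\delta_1\delta_2\ldots$ (letters) and $\Theta=\vartheta_1\vartheta_2\ldots$ (involutory antimorphisms), the generalized pseudostandard word $\mathbf u(\Delta,\Theta)$ is the infinite word whose prefixes $w_n$ are given by $w_0=\varepsilon$ (the empty word), $w_{n+1}=(w_n\delta_{n+1})^{\vartheta_{n+1}}$. The pair $(\Delta,\Theta)$ is its directive bi-sequence.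 An infinite word is eventually periodic if it has the form $wv^{\omega}$ with $w,v$ finite words, $v$ nonempty ($v^\omega$ is the infinite repetition of $v$), and purely periodic if $w$ can be taken empty. It is aperiodic if it is not eventually periodic. Generalized pseudostandard words are either aperiodic or purely periodic, so ''periodic'' may be understood as purely (equivalently, eventually) periodic. *)

(* Defs.v *)
(* MathComp. Letters are booleans: false is 0, true is 1. *)
From mathcomp Require Import all_boot.

Set Implicit Arguments.
Unset Strict Implicit.
Unset Printing Implicit Defensive.

Definition word := seq bool.
Definition infinite_word := nat -> bool.

Definition involutory_antimorphism (f : word -> word) : Prop :=
  (forall v w, f (v ++ w) = f w ++ f v) /\ (forall w, f (f w) = w).

(* R is the reversal, E the exchange antimorphism. *)
Variant antimorphism := R | E.

Definition antimorphism_fun (t : antimorphism) (w : word) : word :=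
  match t with
  | R => rev w
  | E => rev (map negb w)
  end.

Coercion antimorphism_fun : antimorphism >-> Funclass.

Lemma antimorphism_involutory (t : antimorphism) : involutory_antimorphism t.
Proof.
case: t; split=> [v w|w] /=; rewrite ?map_cat ?rev_cat ?map_rev ?revK //.
by rewrite -map_comp map_id_in // => b _; rewrite /= negbK.
Qed.

Lemma involutory_antimorphismE (f : word -> word) :
  involutory_antimorphism f -> exists t : antimorphism, f =1 t.
Proof.
case=> fM fK.
have f0 : f [::] = [::].
  by apply/size0nil; have /(congr1 size) := fM [::] [::];
     rewrite size_cat => /eqP; rewrite -{1}[size _]addn0 eqn_add2l => /eqP/esym.
have fcons b w : f (b :: w) = f w ++ f [:: b] by rewrite -cat1s fM.
have fne w : w != [::] -> 0 < size (f w).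
  by case: w => // b w _; rewrite lt0n size_eq0; apply/eqP => fw0;
     have := fK (b :: w); rewrite fw0 f0.
have size_f w : size w <= size (f w).
  elim: w => //= b w IHw; rewrite fcons size_cat -addn1.
  by apply: leq_add => //; apply: fne.
have f1 b : exists c, f [:: b] = [:: c].
  have := size_f (f [:: b]); rewrite fK /=; have := fne [:: b] isT.
  by case: (f [:: b]) => [|c [|d s]] // _ _; exists c.
have [c fF] := f1 false; have [d fT] := f1 true.
have cd : d = ~~ c.
  have : c != d.
    by apply/eqP => ecd; have := fK [:: false]; rewrite fF ecd -fT fK.
  by case: c d {fF fT} => [] [].
exists (if c then E else R) => w; elim: w => [|b w IHw].
  by rewrite f0; case: (c).
rewrite fcons IHw; case: b; rewrite ?fF ?fT ?cd;
by case: (c) => /=; rewrite rev_cons cats1.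
Qed.

Definition theta_palindrome (t : antimorphism) (w : word) : bool := w == t w.

Definition has_closure_of_size (t : antimorphism) (w : word) (n : nat) : bool :=
  [exists p : n.-tuple bool, theta_palindrome t p && prefix w p].

Lemma has_closure_of_size_ex (t : antimorphism) (w : word) :
  exists n, has_closure_of_size t w n.
Proof.
exists (size (w ++ t w)); apply/existsP; exists (in_tuple (w ++ t w)) => /=.
have [tM tK] := antimorphism_involutory t.
by rewrite /theta_palindrome tM tK eqxx prefix_prefix.
Qed.

Definition closure_size (t : antimorphism) (w : word) : nat :=
  ex_minn (has_closure_of_size_ex t w).

Lemma closure_size_attained (t : antimorphism) (w : word) :
  exists p : (closure_size t w).-tuple bool,
    theta_palindrome t p && prefix w p.
Proof. by apply/existsP; rewrite /closure_size; case: ex_minnP. Qed.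

Definition palindromic_closure (t : antimorphism) (w : word) : word :=
  xchoose (closure_size_attained t w).

(* This determines the closure: a theta-palindrome with prefix w and size at
   most twice that of w is determined by its size. *)
Lemma palindromic_closureP (t : antimorphism) (w : word) :
  [/\ theta_palindrome t (palindromic_closure t w),
      prefix w (palindromic_closure t w)
    & forall p, theta_palindrome t p -> prefix w p ->
        size (palindromic_closure t w) <= size p].
Proof.
have /andP[pal pre] := xchooseP (closure_size_attained t w).
split=> // p p_pal p_pre; rewrite size_tuple /closure_size.
case: ex_minnP => n _; apply; apply/existsP; exists (in_tuple p).
by rewrite p_pal.
Qed.

(* Directive sequences are indexed from 1, so that delta_n is Delta n; the
   entries Delta 0 and Theta 0 are never used. *)
Fixpoint pseudostandard_prefix
    (Delta : nat -> bool) (Theta : nat -> antimorphism) (n : nat) : word :=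
  if n is m.+1 then
    palindromic_closure (Theta m.+1)
      (rcons (pseudostandard_prefix Delta Theta m) (Delta m.+1))
  else [::].

(* Letters of an infinite word are indexed from 0. The (i+1)-st prefix w_(i+1)
   has more than i letters, hence contains the letter at position i. *)
Definition pseudostandard_word
    (Delta : nat -> bool) (Theta : nat -> antimorphism) : infinite_word :=
  fun i => nth false (pseudostandard_prefix Delta Theta i.+1) i.

Lemma pseudostandard_prefix_size Delta Theta n :
  n <= size (pseudostandard_prefix Delta Theta n).
Proof.
elim: n => //= n IHn.
have [_ /size_prefix + _] := palindromic_closureP (Theta n.+1)
  (rcons (pseudostandard_prefix Delta Theta n) (Delta n.+1)).
by rewrite size_rcons; apply: leq_trans.
Qed.

Lemma pseudostandard_prefix_le Delta Theta m n : m <= n ->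
  prefix (pseudostandard_prefix Delta Theta m)
         (pseudostandard_prefix Delta Theta n).
Proof.
elim: n => [|n IHn]; first by rewrite leqn0 => /eqP->; apply: prefix_refl.
rewrite leq_eqVlt => /orP[/eqP->|/IHn le_mn]; first exact: prefix_refl.
apply: prefix_trans le_mn _ => /=.
have [_ + _] := palindromic_closureP (Theta n.+1)
  (rcons (pseudostandard_prefix Delta Theta n) (Delta n.+1)).
by apply: prefix_trans; apply: prefix_rcons.
Qed.

Lemma pseudostandard_wordP Delta Theta n :
  let w := pseudostandard_prefix Delta Theta n in
  w = mkseq (pseudostandard_word Delta Theta) (size w).
Proof.
move=> w; apply: (@eq_from_nth _ false) => [|i lt_i]; rewrite ?size_mkseq //.
rewrite nth_mkseq // /pseudostandard_word.
have lt_i' := pseudostandard_prefix_size Delta Theta i.+1.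
rewrite {}/w in lt_i *.
case: (leqP n i.+1) => [|/ltnW] /(pseudostandard_prefix_le Delta Theta);
  by case/prefixP=> s ->; rewrite nth_cat ?lt_i ?lt_i'.
Qed.

Definition infinite_cat (w : word) (x : infinite_word) : infinite_word :=
  fun i => if i < size w then nth false w i else x (i - size w).

(* Meaningful only for nonempty v. *)
Definition infinite_repetition (v : word) : infinite_word :=
  fun i => nth false v (i %% size v).

Definition eventually_periodic (u : infinite_word) : Prop :=
  exists w v : word,
    v <> [::] /\ u =1 infinite_cat w (infinite_repetition v).

Definition purely_periodic (u : infinite_word) : Prop :=
  exists v : word, v <> [::] /\ u =1 infinite_repetition v.

(* Main.v *)
(* Write s_n = 1 if vartheta_n = E and s_n = 0 if vartheta_n = R. The condition
   says that delta_(n+1) + s_n (mod 2) is eventually a constant b.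

   If u has eventual period q, then for large n the letter after w_n is
   u_(|w_n| - q), which is u_(q-1) + s_n because w_n is a palindrome; so
   b = u_(q-1).

   Conversely, if delta_(n+1) + s_n = b for large n, then b w_n delta_(n+1) is a
   vartheta_n-palindromic prefix of x = b u, of length l_n say, and
   l_(n+1) = 2 l_n - m where m is the length of the longest proper
   vartheta_(n+1)-palindromic prefix of it. Hence if s is eventually constant,
   the gaps l_(n+1) - l_n, which are periods, do not increase. Otherwise, after a
   change of type with gap p, the prefix has antiperiod p and no palindromic
   prefix of its own type is shorter than it by less than 2p. If the type stays
   the same, the next gap is exactly 2p and the antiperiod persists; if it
   changes, the next gap is at most p. Either way the prefixes of x have bounded
   periods. *)
Require Import Defs.
From mathcomp Require Import all_boot zify.
From Stdlib Require Import Classical_Prop.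

Set Implicit Arguments.
Unset Strict Implicit.
Unset Printing Implicit Defensive.

(** * Palindromic prefixes, periods and antiperiods of an infinite word *)

Definition is_exchange (t : antimorphism) : bool :=
  if t is E then true else false.

Definition pal_prefix (x : infinite_word) (s : bool) (l : nat) : Prop :=
  forall i, i < l -> x i = x (l - i.+1) (+) s.

(** An ordinary period for [c = false], an antiperiod for [c = true]. *)
Definition twisted_period (x : infinite_word) (c : bool) (p l : nat) : Prop :=
  forall i, i + p < l -> x (i + p) = x i (+) c.

Section Palindromes.
Variable x : infinite_word.

(** Two reflections compose to a shift, and their exchanges add mod 2. *)
Lemma pal_prefix_twisted_period s s' l m : m <= l ->
  pal_prefix x s l -> pal_prefix x s' m ->
  twisted_period x (s (+) s') (l - m) l.
Proof.
move=> le_ml pal_l pal_m i lt_il.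
rewrite pal_l // (pal_m i); last lia.
have -> : l - (i + (l - m)).+1 = m - i.+1 by lia.
by case: (x _) s s' {pal_l pal_m} => [] [] [].
Qed.

Lemma twisted_period_pal_prefix s c p l : p <= l ->
  pal_prefix x s l -> twisted_period x c p l ->
  pal_prefix x (s (+) c) (l - p).
Proof.
move=> le_pl pal_l per_l i lt_i.
have := per_l i; rewrite pal_l; last lia.
have -> : l - (i + p).+1 = l - p - i.+1 by lia.
move=> e; rewrite addbA e; last lia.
by rewrite addbK.
Qed.

Lemma twisted_periodW c p l m : m <= l ->
  twisted_period x c p l -> twisted_period x c p m.
Proof. by move=> le_ml per_l i lt_i; apply: per_l; lia. Qed.

Lemma twisted_period_double c p l :
  twisted_period x c p l -> twisted_period x false p.*2 l.
Proof.
move=> per_l i lt_i; have -> : i + p.*2 = i + p + p by lia.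
by rewrite !per_l ?addbK ?addbF //; lia.
Qed.

Lemma twisted_period_mul k p l :
  twisted_period x false p l -> twisted_period x false (k * p) l.
Proof.
move=> per_l; elim: k => [|k IHk] i lt_i; first by rewrite mul0n addn0 addbF.
have -> : i + k.+1 * p = i + k * p + p by lia.
by rewrite per_l ?IHk ?addbF //; lia.
Qed.

(** Positions beyond [l] are moved back by [p.*2], to where the given period applies. *)
Lemma twisted_period_extend c p l l' : p.*2 <= l -> l' <= l + p.*2 ->
  twisted_period x c p l -> twisted_period x false p.*2 l' ->
  twisted_period x c p l'.
Proof.
move=> le_pl le_l' per_p per_2p i lt_i.
case: (ltnP (i + p) l) => [/per_p //|le_l].
have e1 : x (i + p) = x (i - p).
  by have := per_2p (i - p); rewrite addbF => <-; [congr x|]; lia.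
case: (ltnP i l) => [lt_il|le_li].
  have := per_p (i - p); rewrite subnK; last lia.
  by move=> -> //; rewrite e1 addbK.
have e2 : x i = x (i - p.*2).
  by have := per_2p (i - p.*2); rewrite addbF => <-; [congr x|]; lia.
rewrite e1 e2 -per_p; [congr x|]; lia.
Qed.

(** The suffix of length [m] is also a palindrome of type [s']; reflecting the prefix of length [l]
    in its centre gives [y]. *)
Lemma pal_prefix_closure s s' l m : m <= l ->
  pal_prefix x s l -> pal_prefix x s' m ->
  exists2 y, pal_prefix y s' (l.*2 - m) & forall i, i < l -> y i = x i.
Proof.
move=> le_ml pal_l pal_m.
exists (fun i => if i < l then x i else x (l.*2 - m - i.+1) (+) s'); last first.
  by move=> i ->.
move=> i lt_i; case: (ltnP i l) => [lt_il|le_li]; last first.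
  by have -> : l.*2 - m - i.+1 < l by lia.
case: (ltnP _ l) => [lt_il'|le_li'].
  have := pal_prefix_twisted_period le_ml pal_l pal_m => per_l.
  rewrite pal_l //; have -> : l.*2 - m - i.+1 = l - i.+1 + (l - m) by lia.
  rewrite per_l; last lia.
  by case: (x _) s s' {pal_l pal_m per_l} => [] [] [].
have -> : l.*2 - m - (l.*2 - m - i.+1).+1 = i by lia.
by rewrite addbK.
Qed.

Lemma pal_prefix_inj s s' l : 0 < l ->
  pal_prefix x s l -> pal_prefix x s' l -> s = s'.
Proof.
by move=> l_gt0 /(_ 0 l_gt0) + /(_ 0 l_gt0) => -> /addbI.
Qed.

End Palindromes.

(** * Gaps between successive palindromic prefixes *)

Section Gaps.
Variables (x : infinite_word) (s : nat -> bool) (l : nat -> nat).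
Hypothesis pal_l : forall n, pal_prefix x (s n) (l n).
Hypothesis l_gt0 : forall n, 0 < l n.
Hypothesis l_incr : forall n, l n < l n.+1.
(** This and [l_next_min] express minimality of the closure: here against a palindrome built by
    reflection, which may leave [x], there against prefixes of [x]. *)
Hypothesis l_next_le : forall n m, m < l n ->
  pal_prefix x (s n.+1) m -> l n.+1 <= (l n).*2 - m.
Hypothesis l_next_min : forall n m, l n < m ->
  pal_prefix x (s n.+1) m -> l n.+1 <= m.

Lemma l_ge_id n : n <= l n.
Proof. by elim: n => // n IHn; have := l_incr n; lia. Qed.

(* The longest proper palindromic prefix of type [s n] of the prefix of size
   [l n] has size [l n - p.*2]; the antiperiod provides it. *)
Definition anti_gap n p :=
  [/\ 0 < p, p.*2 <= l n, twisted_period x true p (l n) &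
      forall m, l n - p.*2 < m < l n -> ~ pal_prefix x (s n) m].

Lemma anti_gap_change n : s n.+1 = ~~ s n -> anti_gap n.+1 (l n.+1 - l n).
Proof.
move=> s_change; have lt_l := l_incr n.
(* The empty prefix is a palindrome of every type; this yields [p.*2 <= l n.+1] for the new gap
   [p]. *)
have le_2l : l n.+1 <= (l n).*2 - 0 by apply: l_next_le.
split; [lia|lia| |].
  have := pal_prefix_twisted_period (ltnW lt_l) (@pal_l n.+1) (@pal_l n).
  by rewrite s_change addNb addbb.
move=> m lt_m pal_m; case: (ltngtP m (l n)) => [lt_ml|lt_lm|eq_ml].
- by have := l_next_le lt_ml pal_m; lia.
- by have := l_next_min lt_lm pal_m; lia.
move: pal_m; rewrite eq_ml => /(pal_prefix_inj (l_gt0 n) (@pal_l n)).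
by rewrite s_change; case: (s n).
Qed.

Lemma anti_gap_same n p : s n.+1 = s n -> anti_gap n p -> anti_gap n.+1 p.
Proof.
move=> s_same [p_gt0 le_pl per_p no_pal]; have lt_l := l_incr n.
have pal_next := @pal_l n.+1; rewrite s_same in pal_next.
have per_next : twisted_period x false (l n.+1 - l n) (l n.+1).
  by have := pal_prefix_twisted_period (ltnW lt_l) pal_next (@pal_l n);
     rewrite addbb.
have le_next : l n.+1 <= l n + p.*2.
  have := @l_next_le n (l n - p.*2); rewrite s_same => le_next.
  suff : l n.+1 <= (l n).*2 - (l n - p.*2) by lia.
  apply: le_next; first lia.
  rewrite -[s n]addbF.
  apply: twisted_period_pal_prefix le_pl (@pal_l n) _.
  exact: twisted_period_double per_p.
(* A smaller gap would be a period of the prefix of length [l n], and so give a palindromic prefix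
   excluded by [no_pal]. *)
have next_eq : l n.+1 - l n = p.*2.
  apply/eqP; rewrite eqn_leq leq_subLR le_next leqNgt; apply/negP => lt_gap.
  apply: (no_pal (l n - (l n.+1 - l n))); first lia.
  rewrite -[s n]addbF; apply: twisted_period_pal_prefix (@pal_l n) _; first lia.
  exact: twisted_periodW (ltnW lt_l) per_next.
rewrite next_eq in per_next; split=> //; first lia.
  exact: twisted_period_extend le_pl le_next per_p per_next.
move=> m lt_m pal_m.
by have := @l_next_min n m _ pal_m; lia.
Qed.

Lemma anti_gap_next n p : anti_gap n p ->
  exists2 p', p' <= p & anti_gap n.+1 p'.
Proof.
move=> gap; have [/(anti_gap_same)/(_ gap)|s_change] := eqVneq (s n.+1) (s n).
  by exists p.
have {}s_change : s n.+1 = ~~ s n by case: (s n.+1) (s n) s_change => [] [].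
exists (l n.+1 - l n); last exact: anti_gap_change.
have [p_gt0 le_pl per_p _] := gap.
have := @l_next_le n (l n - p); rewrite s_change -addbT => le_next.
suff : l n.+1 <= (l n).*2 - (l n - p) by lia.
apply: le_next; first lia.
by apply: twisted_period_pal_prefix (@pal_l n) per_p; lia.
Qed.

Lemma bounded_periods : exists B n0, forall n, n0 <= n ->
  exists2 p, 0 < p <= B & twisted_period x false p (l n).
Proof.
have [all_same|[n0 s_change]] :
    (forall n, s n.+1 = s n) \/ (exists n, s n.+1 = ~~ s n).
  have [ex_change|no_change] := classic (exists n, s n.+1 = ~~ s n).
    by right.
  left=> n; apply/eqP/negP => neq_s; apply: no_change; exists n.
  by case: (s n.+1) (s n) neq_s => [] [].
(* Gaps do not increase: [l n] is a palindromic prefix of the right type for the step from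
   [l n.+1]. *)
- exists (l 1 - l 0), 1 => - [//|n] _; have lt_l := l_incr n.
  exists (l n.+1 - l n); last first.
    have := pal_prefix_twisted_period (ltnW lt_l) (@pal_l n.+1) (@pal_l n).
    by rewrite all_same addbb.
  rewrite subn_gt0 lt_l /=; elim: n {lt_l} => // n IHn.
  have := @l_next_le n.+1 (l n) (l_incr n); rewrite !all_same.
  by move/(_ (@pal_l n)); have := l_incr n; have := l_incr n.+1; lia.
set p0 := l n0.+1 - l n0.
have gaps n : n0 < n -> exists2 p, p <= p0 & anti_gap n p.
  elim: n => // n IHn; rewrite ltnS leq_eqVlt => /orP[/eqP <-|/IHn].
    by exists p0 => //; apply: anti_gap_change.
  case=> p le_p /anti_gap_next[p' le_p' gap].
  by exists p' => //; apply: leq_trans le_p.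
exists p0.*2, n0.+1 => n /gaps[p le_p [p_gt0 _ /twisted_period_double per_p _]].
by exists p.*2 => //; lia.
Qed.

Lemma gaps_periodic : exists2 q, 0 < q & forall i, x (i + q) = x i.
Proof.
have [B [n0 periods]] := bounded_periods.
(* The factorial is a common multiple of all the periods, which vary with the prefix. *)
exists B`! => [|i]; first exact: fact_gt0.
set n := maxn n0 (i + B`!).+1.
have [p le_p per_p] := periods n (leq_maxl _ _).
have /dvdnP[k eq_k] := dvdn_fact le_p.
have := @twisted_period_mul x k p _ per_p; rewrite -eq_k => /(_ i).
rewrite addbF; apply.
by apply: leq_trans (l_ge_id n); rewrite leq_max leqnn orbT.
Qed.

End Gaps.

(** * Application to pseudostandard words *)

Lemma eq_pal_prefix x y s l : (forall i, i < l -> x i = y i) ->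
  pal_prefix x s l -> pal_prefix y s l.
Proof.
move=> eq_xy pal_x i lt_i.
rewrite -(eq_xy i) // -(eq_xy (l - i.+1)); [exact: pal_x | lia].
Qed.

Lemma theta_palindromeP t w :
  reflect (pal_prefix (nth false w) (is_exchange t) (size w))
          (theta_palindrome t w).
Proof.
have size_t : size (t w) = size w by case: t; rewrite /= size_rev ?size_map.
have nth_t i : i < size w ->
    nth false (t w) i = nth false w (size w - i.+1) (+) is_exchange t.
  move=> lt_i; case: t {size_t} => /=; rewrite nth_rev ?size_map ?addbF //.
  by rewrite (nth_map false) ?addbT //; lia.
apply: (iffP eqP) => [pal_w i lt_i|pal_w]; first by rewrite {1}pal_w nth_t.
by apply: (@eq_from_nth _ false) => // i lt_i; rewrite nth_t //; apply: pal_w.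
Qed.

Section Pseudostandard.
Variables (Delta : nat -> bool) (Theta : nat -> antimorphism).
Local Notation u := (pseudostandard_word Delta Theta).
Local Notation w := (pseudostandard_prefix Delta Theta).
Local Notation L n := (size (w n)).
Local Notation sg n := (is_exchange (Theta n)).

Lemma nth_pseudostandard_prefix n i : i < L n -> nth false (w n) i = u i.
Proof. by move=> lt_i; rewrite pseudostandard_wordP nth_mkseq. Qed.

Lemma prefix_next n : prefix (rcons (w n) (Delta n.+1)) (w n.+1).
Proof.
by have [] := palindromic_closureP (Theta n.+1) (rcons (w n) (Delta n.+1)).
Qed.

Lemma size_next n : L n < L n.+1.
Proof. by have /size_prefix := prefix_next n; rewrite size_rcons. Qed.

Lemma pseudostandard_word_size n : u (L n) = Delta n.+1.
Proof.
rewrite -(@nth_pseudostandard_prefix n.+1) ?size_next //.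
have /prefixP[v ->] := prefix_next n.
by rewrite nth_cat size_rcons leqnn nth_rcons ltnn eqxx.
Qed.

Lemma pal_prefix_pseudostandard n : pal_prefix u (sg n) (L n).
Proof.
case: n => // n.
have [/theta_palindromeP pal_w _ _] :=
  palindromic_closureP (Theta n.+1) (rcons (w n) (Delta n.+1)).
by apply: eq_pal_prefix pal_w => i; apply: (@nth_pseudostandard_prefix n.+1).
Qed.

Lemma size_next_le n y m : L n < m -> (forall i, i <= L n -> y i = u i) ->
  pal_prefix y (sg n.+1) m -> L n.+1 <= m.
Proof.
move=> lt_m eq_yu pal_y.
have [_ _ /(_ (mkseq y m))] :=
  palindromic_closureP (Theta n.+1) (rcons (w n) (Delta n.+1)).
rewrite size_mkseq; apply.
  apply/theta_palindromeP; rewrite size_mkseq.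
  by apply: eq_pal_prefix pal_y => i lt_i; rewrite nth_mkseq.
rewrite prefixE; apply/eqP/(@eq_from_nth _ false).
  by rewrite size_takel ?size_mkseq size_rcons.
rewrite size_rcons size_takel ?size_mkseq // => i lt_i.
rewrite nth_take // nth_mkseq ?(leq_trans lt_i) // eq_yu // nth_rcons.
case: (ltngtP i (L n)) lt_i => [lt_i _|lt_i|-> _].
- by rewrite nth_pseudostandard_prefix.
- by rewrite ltnS leqNgt lt_i.
by rewrite pseudostandard_word_size.
Qed.

Lemma pseudostandard_periodic b n0 :
  (forall n, n0 < n -> Delta n.+1 (+) sg n = b) ->
  exists2 q, 0 < q & forall i, u (i + q) = u i.
Proof.
move=> const_b.
(* The prefixes of [x] of size 0 (type E) and 1 (type R) account for closures in
   which no palindromic suffix of size at least 2 is available. *)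
pose x i := if i is j.+1 then u j else b.
suff [q q_gt0 per_x] : exists2 q, 0 < q & forall i, x (i + q) = x i.
  by exists q => // i; have := per_x i.+1.
pose k n := n0.+1 + n.
have palx_u s m : pal_prefix x s m.+2 -> pal_prefix u s m.
  move=> pal_x i lt_i; have := pal_x i.+1.
  have -> : m.+2 - i.+2 = (m - i.+1).+1 by lia.
  by apply; lia.
have palx n : n0 < n -> pal_prefix x (sg n) (L n).+2.
  move=> lt_n; have eb := const_b n lt_n.
  case=> [_|i lt_i].
    by rewrite subn1 /= pseudostandard_word_size.
  have [->|neq_i] := eqVneq i (L n).
    by rewrite subnn /= pseudostandard_word_size -eb addbK.
  have -> : (L n).+2 - i.+2 = (L n - i.+1).+1 by lia.
  rewrite /=; apply: pal_prefix_pseudostandard; lia.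
have kS n : k n.+1 = (k n).+1 by apply: addnS.
have lt_k n : n0 < k n by apply: leq_addr.
apply: (@gaps_periodic x (fun n => sg (k n)) (fun n => (L (k n)).+2)) => //.
- by move=> n; apply: palx.
- by move=> n; rewrite kS !ltnS size_next.
- move=> n m lt_m; rewrite kS => pal_m.
  have [y pal_y eq_yx] :=
    pal_prefix_closure (ltnW lt_m) (palx _ (lt_k n)) pal_m.
  (* Removing the first and last letters of [y] leaves a palindrome that competes in the closure. *)
  suff : L (k n).+1 <= (L (k n)).+2.*2 - m - 2 by lia.
  apply: (@size_next_le _ (fun i => y i.+1)); first lia.
    by move=> i le_i; rewrite eq_yx ?ltnS.
  move=> i lt_i; rewrite pal_y; last lia.
  by congr (y _ (+) _); lia.
move=> n [//|[//|m]]; rewrite kS !ltnS => lt_m /palx_u pal_m.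
exact: size_next_le pal_m.
Qed.

End Pseudostandard.

Theorem theorem11 (Delta : nat -> bool) (Theta : nat -> antimorphism) :
  (eventually_periodic (pseudostandard_word Delta Theta) <->
   purely_periodic (pseudostandard_word Delta Theta)) /\
  (purely_periodic (pseudostandard_word Delta Theta) <->
   exists (a : bool) (t : antimorphism) (n0 : nat),
     forall n : nat, n0 < n -> (Delta n.+1 = a <-> Theta n = t)).
Proof.
set u := pseudostandard_word Delta Theta.
have pure_ev : purely_periodic u -> eventually_periodic u.
  case=> v [v_n0 uE]; exists [::], v; split=> // i.
  by rewrite /infinite_cat subn0.
have ev_dir : eventually_periodic u -> exists (a : bool) (t : antimorphism)
    (n0 : nat), forall n : nat, n0 < n -> (Delta n.+1 = a <-> Theta n = t).
  case=> [p [v [v_n0 uE]]]; have v_gt0 : 0 < size v by case: (v) v_n0.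
  have per_u i : size p <= i -> u (i + size v) = u i.
    move=> le_pi; rewrite !uE /infinite_cat /infinite_repetition !ltnNge le_pi.
    rewrite (leq_trans le_pi (leq_addr _ _)) /=.
    by rewrite -addnBAC // modnDr.
  (* For such [n], position [L - size v] lies past the preperiod and mirrors to [(size v).-1] in the
     palindrome of length [L]. *)
  exists (u (size v).-1), R, (size p + size v) => n lt_n.
  have le_L := pseudostandard_prefix_size Delta Theta n.
  set L := size _ in le_L.
  have : u L = u (size v).-1 (+) is_exchange (Theta n).
    have := @pal_prefix_pseudostandard Delta Theta n (L - size v).
    rewrite -/u -/L -per_u; last lia.
    have -> : L - (L - size v).+1 = (size v).-1 by lia.
    by rewrite subnK; [apply|]; lia.
  rewrite /u pseudostandard_word_size => ->.
  case: (Theta n) => /=; rewrite ?addbF ?addbT; split=> //.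
  by case: (pseudostandard_word _ _ _).
have dir_pure : (exists (a : bool) (t : antimorphism)
    (n0 : nat), forall n : nat, n0 < n -> (Delta n.+1 = a <-> Theta n = t)) ->
    purely_periodic u.
  case=> a [t [n0 dir]].
  have [n lt_n|q q_gt0 per_u] :=
    (* Over two letters and two types, the equivalence in [dir] is a linear equation mod 2. *)
    @pseudostandard_periodic Delta Theta (a (+) is_exchange t) n0.
    have := dir n lt_n.
    case: (Delta _) a (Theta n) t {dir} => [] [] [] [] //= [h1 h2];
      by [have := h1 erefl | have := h2 erefl].
  exists (mkseq u q); split=> [|i].
    by move/(congr1 size); rewrite size_mkseq => q0; rewrite q0 in q_gt0.
  rewrite /infinite_repetition size_mkseq nth_mkseq ?ltn_pmod //.
  rewrite {1}(divn_eq i q) addnC; elim: (i %/ q) => [|k IHk].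
    by rewrite addn0.
  by rewrite mulSn [q + _]addnC addnA [LHS]per_u.
by split; split; auto.
Qed.
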